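(* Let $n\ge 3$ and let $\mathcal{F}=\{\Omega_{i_1j_1},\dots,\Omega_{i_mj_m}\}\subseteq\mathcal{B}$, with $1\le i_k<j_k\le n$ for $k=1,\dots,m$, be a set of elements of the standard basis $\mathcal{B}$ of $\mathfrak{so}(n)$. The control system on $\mathrm{SO}(n)$ $$\dot X(t)=\Big[\sum_{k=1}^m u_k(t)\,\Omega_{i_kj_k}\Big]X(t),\qquad X(0)=I,$$ is controllable if and only if there is a subset $\mathcal{S}\subseteq\mathcal{F}$ such that $\iota(\mathcal{S})$ is an $n$-cycle.
   Context: $E_{ij}\in\mathbb{R}^{n\times n}$ is the matrix whose $(i,j)$ entry is $1$ and whose other entries are $0$; $\Omega_{ij}=E_{ij}-E_{ji}$; $\mathcal{B}=\{\Omega_{ij}:1\le i<j\le n\}$ is the standard basis of $\mathfrak{so}(n)$. The controls $u_k(t)\in\mathbb{R}$ are piecewise constant. The system is controllable on $\mathrm{SO}(n)$ if every element of $\mathrm{SO}(n)$ can be reached from $X(0)=I$ in finite time by some choice of controls. $S_n$ is the symmetric group on $\{1,\dots,n\}$, $(i,j)$ denotes the transposition exchanging $i$ and $j$, and $\mathcal{P}(\mathcal{B})$ is the power set of $\mathcal{B}$. The map $\iota:\mathcal{P}(\mathcal{B})\to S_n$ is given by $\{\Omega_{a_1b_1},\dots,\Omega_{a_lb_l}\}\mapsto (a_l,b_l)\cdots(a_2,b_2)(a_1,b_1)$. It is not a well-defined function, since the product depends on the order in which the distinct elements of the set are listed; ''$\iota(\mathcal{S})$ is an $n$-cycle'' means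 that the product of the corresponding transpositions, for some listing of the elements of $\mathcal{S}$ (each listed once), is an $n$-cycle. *)

(* Defs.v *)
From HB Require Import structures.
From mathcomp Require Import all_boot all_order all_fingroup all_algebra.
From mathcomp Require Import all_classical all_reals all_analysis.

Set Implicit Arguments.
Unset Strict Implicit.
Unset Printing Implicit Defensive.

Import Order.TTheory GRing.Theory Num.Theory.
Import numFieldNormedType.Exports.

Local Open Scope classical_set_scope.
Local Open Scope ring_scope.

Definition Omega (R : realType) (n : nat) (i j : 'I_n) : 'M[R]_n :=
  delta_mx i j - delta_mx j i.

Definition SO (R : realType) (n : nat) : set 'M[R]_n :=
  [set Q | Q^T *m Q = 1%:M /\ \det Q = 1].

(* The set of values of the multivalued map iota at [S]: one value for each
   listing of [S] without repetition.  [perm] products compose from left to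
   right, so this big product applies the head of the listing first, i.e. it is
   (a_l, b_l) ... (a_1, b_1) in the right-to-left convention. *)
Definition iota_values (R : realType) (n : nat) (S : set 'M[R]_n) : set 'S_n :=
  [set sigma | exists s : seq ('I_n * 'I_n),
    [/\ uniq s,
        forall p, p \in s -> (p.1 < p.2)%N,
        S = [set Omega R p.1 p.2 | p in [set` s]]
      & sigma = (\prod_(p <- s) tperm p.1 p.2)%g]].

(* [next c] maps each entry of [c] to the cyclically following one and fixes
   the points outside [c]. *)
Definition is_cycle_of_length (n k : nat) (sigma : 'S_n) : Prop :=
  exists c : k.-tuple 'I_n, uniq c /\ forall x, sigma x = next c x.

(* The points of [0 :: s] are the switching times; the values of the controls
   at the switching times themselves are unconstrained. *)
Definition piecewise_constant_on (R : realType) (m : nat) (T : R)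
    (s : seq R) (u : 'I_m -> R -> R) : Prop :=
  itv_partition 0 T s /\
  forall l, (l < size s)%N -> exists c : 'I_m -> R,
    forall t, nth 0 (0 :: s) l < t < nth 0 (0 :: s) l.+1 ->
      forall k, u k t = c k.

(* A solution on [0, T] is continuous and satisfies the equation at all times of
   ]0, T[ that are not switching times. *)
Definition is_trajectory (R : realType) (n m : nat) (A : 'I_m -> 'M[R]_n)
    (T : R) (u : 'I_m -> R -> R) (X : R -> 'M[R]_n) : Prop :=
  exists s : seq R,
    [/\ piecewise_constant_on T s u,
        {within `[0, T], continuous X},
        forall t, 0 <= t <= T -> SO (X t),
        X 0 = 1%:M
      & forall t, 0 < t < T -> t \notin s ->
          is_derive t (1 : R) X ((\sum_(k < m) u k t *: A k) *m X t)].

Definition controllable (R : realType) (n m : nat) (A : 'I_m -> 'M[R]_n) : Prop :=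
  forall Q, SO Q ->
    exists (T : R) (u : 'I_m -> R -> R) (X : R -> 'M[R]_n),
      [/\ 0 <= T, is_trajectory A T u X & X T = Q].

(* Main.v *)
Require Import Defs.
From mathcomp Require Import all_boot all_order all_fingroup all_algebra.
From mathcomp Require Import all_classical all_reals all_analysis.
From mathcomp Require Import ring lra.

Set Implicit Arguments.
Unset Strict Implicit.
Unset Printing Implicit Defensive.

Import Order.TTheory GRing.Theory Num.Theory.
Import numFieldNormedType.Exports.

Local Open Scope classical_set_scope.
Local Open Scope ring_scope.

(** Both conditions are equivalent to a third one: the graph on the indices
whose edges are the pairs [{i k, j k}] is connected.

Controllability versus connectedness.  The one-parameter group of [Omega a b]
is the group of rotations [rotation a b t] of the coordinate plane (a, b), so a
control that is switched on along one edge multiplies the current state on the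
left by an arbitrary rotation in the plane of that edge
([reachable_rotation]).  Conjugating a rotation in the plane (b, c) by the
quarter turn in the plane (a, b) gives the rotation in the plane (a, c)
([rotation_conj]); hence, along paths of a connected graph, all coordinate
rotations become available ([rotation_stable_all]).  Elimination by Givens
rotations then reduces every element of SO(n) to the identity
([rotations_generate_SO]).

Conversely, if a set [C] of indices is not left by any edge, then the
projection onto the coordinates outside [C] commutes with all [Omega (i k)
(j k)], which are skew-symmetric; for [a] in [C], the squared length of the
part of the column [a] of a trajectory that lies outside [C] is therefore
constant, hence 0, as it is 0 at the identity ([reachable_block]).  A quarter
turn that mixes [C] with its complement is then out of reach.

Connectedness versus n-cycles.  Multiplying a cycle by a transposition (a, b)
with [a] on the cycle and [b] off it inserts [b] into the cycle
([next_cons_tperm]).  Growing a tree edge by edge in a connected graph thus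
produces a listing of edges whose product is a cycle through all vertices
([exists_cycle_listing]).  Conversely, a product of transpositions along edges
preserves every union of connected components, whereas the powers of an n-cycle
act transitively ([spans_vertices_of_listing]). *)

(** Connectedness of the graph with edges [{i k, j k}], stated through cuts: a
nonempty set of vertices that no edge leaves is everything.  This form provides
both the edge along which a cycle is enlarged and, when it fails, the invariant
block of the control system. *)
Definition spans_vertices (n m : nat) (i j : 'I_m -> 'I_n) : Prop :=
  forall C : {set 'I_n}, (exists v, v \in C) ->
    (forall k, (i k \in C) = (j k \in C)) -> forall v, v \in C.

(** * Rotations of the coordinate planes *)

(** The closed form of the exponential of [t *: Omega R a b] for distinct [a]
and [b]. *)
Definition rotation (R : realType) (n : nat) (a b : 'I_n) (t : R) : 'M[R]_n :=
  1%:M + (cos t - 1) *: (delta_mx a a + delta_mx b b) + sin t *: Omega R a b.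

Lemma mul_delta_mxE (R : pzRingType) (n p : nat) (a b : 'I_n)
    (M : 'M[R]_(n, p)) x y :
  (delta_mx a b *m M) x y = (x == a)%:R * M b y.
Proof.
rewrite mxE (bigD1 b) //= big1 ?addr0 => [|z zb].
  by rewrite mxE eqxx andbT.
by rewrite mxE (negbTE zb) andbF mul0r.
Qed.

Lemma mul_OmegaE (R : realType) (n : nat) (a b : 'I_n) (M : 'M[R]_n) x y :
  (Omega R a b *m M) x y = (x == a)%:R * M b y - (x == b)%:R * M a y.
Proof. by rewrite mulmxBl mxE [in X in _ + X]mxE !mul_delta_mxE. Qed.

Lemma mul_rotationE (R : realType) (n : nat) (a b : 'I_n) (t : R) (M : 'M[R]_n) x y :
  a != b ->
  (rotation a b t *m M) x y =
    if x == a then cos t * M a y + sin t * M b y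
    else if x == b then - sin t * M a y + cos t * M b y else M x y.
Proof.
move=> ab; rewrite /rotation !mulmxDl mul1mx -!scalemxAl mulmxDl.
have addE (A B : 'M[R]_n) : (A + B) x y = A x y + B x y by rewrite mxE.
have scaleE (l : R) (A : 'M[R]_n) : (l *: A) x y = l * A x y by rewrite mxE.
rewrite !(addE, scaleE) mul_OmegaE !mul_delta_mxE.
case: (eqVneq x a) => [->|xa].
  by rewrite ?eqxx (negbTE ab) /=; ring.
by case: (eqVneq x b) => [->|xb] /=; ring.
Qed.

Lemma rotation0 (R : realType) (n : nat) (a b : 'I_n) :
  rotation a b (0 : R) = 1%:M.
Proof. by rewrite /rotation cos0 sin0 subrr !scale0r !addr0. Qed.

Lemma rotationD (R : realType) (n : nat) (a b : 'I_n) (s t : R) :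
  a != b -> rotation a b s *m rotation a b t = rotation a b (s + t).
Proof.
move=> ab; rewrite -[LHS]mulmx1 -[RHS]mulmx1 -mulmxA; apply/matrixP => x y.
rewrite !mul_rotationE // !eqxx [b == a]eq_sym (negbTE ab) cosD sinD.
by case: eqP => _; [ring|case: eqP => _ //; ring].
Qed.

Lemma rotationN (R : realType) (n : nat) (a b : 'I_n) (t : R) :
  rotation a b (- t) = (rotation a b t)^T.
Proof.
rewrite /rotation cosN sinN; apply/matrixP => x y; rewrite !mxE.
by rewrite [y == x]eq_sym ![(y == _) && _]andbC; ring.
Qed.

Lemma rotationNK (R : realType) (n : nat) (a b : 'I_n) (t : R) (Q : 'M[R]_n) :
  a != b -> rotation a b (- t) *m (rotation a b t *m Q) = Q.
Proof. by move=> ab; rewrite mulmxA rotationD // addNr rotation0 mul1mx. Qed.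

Lemma SO1 (R : realType) (n : nat) : SO (1%:M : 'M[R]_n).
Proof. by split; rewrite ?trmx1 ?mul1mx ?det1. Qed.

Lemma SO_mulmx (R : realType) (n : nat) (P Q : 'M[R]_n) :
  SO P -> SO Q -> SO (P *m Q).
Proof.
move=> [P1 P2] [Q1 Q2]; split; last by rewrite det_mulmx P2 Q2 mulr1.
by rewrite trmx_mul mulmxA -[_ *m P^T *m P]mulmxA P1 mulmx1.
Qed.

(** Orthogonality only gives a determinant of square 1; its sign is settled by
writing the rotation as the square of the rotation by half the angle. *)
Lemma SO_rotation (R : realType) (n : nat) (a b : 'I_n) (t : R) :
  a != b -> SO (rotation a b t).
Proof.
move=> ab; have orth (s : R) : (rotation a b s)^T *m rotation a b s = 1%:M.
  by rewrite -rotationN rotationD // addNr rotation0.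
split; first exact: orth.
have /(congr1 determinant) := orth t.
have -> : t = t / 2 + t / 2 by field.
rewrite -rotationD // trmx_mul !det_mulmx !det_tr det1 -!expr2 => /eqP.
by rewrite sqrp_eq1 ?sqr_ge0 // => /eqP.
Qed.

Lemma rotationC (R : realType) (n : nat) (a b : 'I_n) (t : R) :
  rotation b a t = rotation a b (- t).
Proof.
rewrite /rotation cosN sinN [delta_mx b b + _]addrC.
by rewrite /Omega -[delta_mx b a - _]opprB scalerN scaleNr.
Qed.

(** The quarter turn carries the axis of [b] to that of [a], so it carries
rotations of the plane (b, c) to rotations of the plane (a, c).  At the level
of Lie algebras this is the fact that the bracket of [Omega a b] and
[Omega b c] is [Omega a c]. *)
Lemma rotation_conj (R : realType) (n : nat) (a b c : 'I_n) (t : R) (Q : 'M[R]_n) :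
  a != b -> b != c -> a != c ->
  rotation a b (pi / 2) *m (rotation b c t *m (rotation a b (- (pi / 2)) *m Q))
  = rotation a c t *m Q.
Proof.
move=> ab bc ac; apply/matrixP => x y.
rewrite !mul_rotationE // !eqxx [b == a]eq_sym [c == a]eq_sym [c == b]eq_sym.
rewrite (negbTE ab) (negbTE bc) (negbTE ac).
rewrite cosN sinN cos_pihalf sin_pihalf.
case: (eqVneq x a) => [_|xa]; first by ring.
case: (eqVneq x b) => [->|xb]; first by rewrite (negbTE bc); ring.
by case: (eqVneq x c) => [_|xc] //; ring.
Qed.

(** * Generation of SO(n) by rotations *)

Lemma exists_angle (R : realType) (x y : R) :
  x ^+ 2 + y ^+ 2 = 1 -> exists t : R, cos t = x /\ sin t = y.
Proof.
move=> xy; have x1 : -1 <= x <= 1 by apply/andP; split; nra.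
have yE : Num.sqrt (1 - x ^+ 2) = `|y| by rewrite -xy addrAC subrr add0r sqrtr_sqr.
have [y0|y0] := lerP 0 y; [exists (acos x)|exists (- acos x)].
  by rewrite acosK ?in_itv // sin_acos // yE ger0_norm.
by rewrite cosN sinN acosK ?in_itv // sin_acos // yE ltr0_norm // opprK.
Qed.

(** The Givens angle: the plane vector (x, y) can be rotated onto the
nonnegative half of the first axis.  The sign matters: it makes the pivots of
the elimination equal to 1 and not -1. *)
Lemma exists_annihilating_angle (R : realType) (x y : R) :
  exists t : R, - sin t * x + cos t * y = 0 /\ 0 <= cos t * x + sin t * y.
Proof.
pose r := Num.sqrt (x ^+ 2 + y ^+ 2).
have r2 : r ^+ 2 = x ^+ 2 + y ^+ 2 by rewrite sqr_sqrtr // addr_ge0 ?sqr_ge0.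
have [r0|rn0] := eqVneq r 0.
  have [x0 y0] : x = 0 /\ y = 0.
    move: r2; rewrite r0 expr0n /= => /esym/eqP.
    by rewrite paddr_eq0 ?sqr_ge0 // !sqrf_eq0 => /andP[/eqP ? /eqP ?].
  by exists 0; rewrite x0 y0 !mulr0 addr0.
have rgt0 : 0 < r by rewrite lt_neqAle eq_sym rn0 sqrtr_ge0.
have [|t [tx ty]] := @exists_angle R (x / r) (y / r).
  by rewrite !expr_div_n -mulrDl -r2 divff // expf_neq0.
exists t; rewrite tx ty; split; first by field.
rewrite mulrAC [y / r * y]mulrAC -!expr2 -mulrDl divr_ge0 ?(ltW rgt0) //.
by rewrite addr_ge0 ?sqr_ge0.
Qed.

Definition fixes_basis (R : realType) (n : nat) (A : {set 'I_n})
    (Q : 'M[R]_n) : Prop :=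
  forall a x, a \in A -> Q x a = (x == a)%:R.

(** The entry (a, x) of [Q^T *m Q] reduces to [Q a x] when column [a] of [Q] is a
basis vector. *)
Lemma fixes_basis_row (R : realType) (n : nat) (A : {set 'I_n}) (Q : 'M[R]_n) a x :
  Q^T *m Q = 1%:M -> fixes_basis A Q -> a \in A -> Q a x = (a == x)%:R.
Proof.
move=> QQ fA aA; have /matrixP/(_ a x) := QQ.
rewrite !mxE (bigD1 a) //= big1 ?addr0 => [|y ya]; last first.
  by rewrite mxE fA // (negbTE ya) mul0r.
by rewrite mxE fA // eqxx mul1r => ->.
Qed.

Definition rotation_stable (R : realType) (n : nat) (P : 'M[R]_n -> Prop)
    (a b : 'I_n) : Prop :=
  forall t Q, P Q -> P (rotation a b t *m Q).

Lemma rotation_stable_sym (R : realType) (n : nat) (P : 'M[R]_n -> Prop) a b :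
  rotation_stable P a b -> rotation_stable P b a.
Proof. by move=> Pab t Q PQ; rewrite rotationC; apply: Pab. Qed.

Lemma rotation_stable_trans (R : realType) (n : nat) (P : 'M[R]_n -> Prop) a b c :
  a != b -> b != c -> a != c ->
  rotation_stable P a b -> rotation_stable P b c -> rotation_stable P a c.
Proof.
move=> ab bc ac Pab Pbc t Q PQ; rewrite -(rotation_conj t Q ab bc ac).
by apply: (Pab); apply: Pbc; apply: Pab.
Qed.

(** For a fixed [a], the vertices [v] for which rotations in the plane (a, v) are
available form, together with [a], a set that no edge leaves. *)
Lemma rotation_stable_all (R : realType) (n m : nat) (i j : 'I_m -> 'I_n)
    (P : 'M[R]_n -> Prop) :
  spans_vertices i j -> (forall k, i k != j k) ->
  (forall k, rotation_stable P (i k) (j k)) ->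
  forall a b, a != b -> rotation_stable P a b.
Proof.
move=> conn ij Pij a b ab.
pose C := [set v | (v == a) || `[< rotation_stable P a v >]]%SET.
have CP v : v \in C <-> v = a \/ rotation_stable P a v.
  rewrite inE; split=> [/orP[/eqP|/asboolP]|[->|/asboolP ->]]; first by left.
  - by right.
  - by rewrite eqxx.
  - by rewrite orbT.
have step u v : u != v -> rotation_stable P u v -> u \in C -> v \in C.
  move=> uv Puv /CP[ua|Pau]; apply/CP; first by right; rewrite -ua.
  have [->|va] := eqVneq v a; first by left.
  right; have [au|au] := eqVneq a u; first by rewrite au.
  by apply: rotation_stable_trans Puv => //; rewrite eq_sym.
suff /CP[ba|//] : b \in C by rewrite ba eqxx in ab.
apply: conn => [|k]; first by exists a; apply/CP; left.
apply/idP/idP; apply: step => //; first by rewrite eq_sym.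
exact: rotation_stable_sym.
Qed.

(** Givens elimination, by induction on the number of columns that are not yet
basis vectors.  A pivot [v] among the remaining indices is chosen, and the other
remaining entries of its column are cleared one at a time by rotations in the
planes (v, b); these do not disturb the columns that are already in place.  The
column has length 1 and a nonnegative pivot, so it ends up being a basis vector.
When [v] is the only remaining index there is nothing to rotate, and the sign
of the pivot comes from the determinant. *)
Lemma rotations_generate_SO (R : realType) (n : nat) (P : 'M[R]_n -> Prop) :
  P 1%:M -> (forall a b, a != b -> rotation_stable P a b) ->
  forall Q, SO Q -> P Q.
Proof.
move=> P1 Pab.
suff main r A Q : #|~: A|%SET = r -> SO Q -> fixes_basis A Q -> P Q.
  move=> Q SOQ; apply: (main _ finset.set0 Q erefl SOQ) => a x.
  by rewrite inE.
elim: r A Q => [|r IH] A Q cA SOQ fA.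
  suff -> : Q = 1%:M by [].
  apply/matrixP => x y; rewrite fA ?mxE //.
  by have := cards0_eq cA => /setP/(_ y); rewrite !inE => /negbFE.
have [v] : exists v, v \in (~: A)%SET by apply/card_gt0P; rewrite cA.
rewrite inE => vA.
(* [l] lists the entries of column [v] that remain to be cleared. *)
have inner (l : seq 'I_n) : forall Q, SO Q -> fixes_basis A Q ->
    (forall b, b \in l -> b \notin A /\ b != v) ->
    (forall x, x \notin l -> x != v -> Q x v = 0) ->
    (l = [::] -> 0 <= Q v v) -> P Q.
  elim: l => [|b l IHl] {SOQ fA}Q SOQ fA lA Q0 Qvv.
    have Qv1 : Q v v = 1.
      have [/matrixP/(_ v v) + _] := SOQ.
      rewrite !mxE eqxx (bigD1 v) //= big1 ?addr0 => [|y yv]; last first.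
        by rewrite Q0 // mulr0.
      by rewrite mxE -expr2 => /eqP; rewrite sqrp_eq1 ?Qvv // => /eqP.
    apply: (IH (v |: A)%SET) => //.
      move: cA; rewrite (cardsD1 v) inE vA add1n => -[<-].
      by apply: eq_card => x; rewrite !inE negb_or.
    move=> a x; rewrite !inE => /orP[/eqP ->|]; last exact: fA.
    by have [->|xv] := eqVneq x v; rewrite ?Qv1 ?Q0.
  have [bA bv] := lA b (mem_head _ _).
  have vb : v != b by rewrite eq_sym.
  have [t [t0 tge]] := exists_annihilating_angle (Q v v) (Q b v).
  rewrite -(rotationNK t Q vb); apply: Pab => //; apply: IHl.
  - exact: SO_mulmx (SO_rotation _ vb) SOQ.
  - move=> a x aA; have av : a != v by apply: contraNneq vA => <-.
    have ab : a != b by apply: contraNneq bA => <-.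
    rewrite mul_rotationE // !(fA a) // [v == a]eq_sym [b == a]eq_sym.
    rewrite (negbTE av) (negbTE ab) /= !mulr0 addr0.
    case: eqP => [->|_]; first by rewrite eq_sym (negbTE av).
    by case: eqP => [->|//]; rewrite eq_sym (negbTE ab).
  - by move=> c cl; apply: lA; rewrite inE cl orbT.
  - move=> x xl xv; rewrite mul_rotationE // (negbTE xv).
    by case: eqVneq => // xb; apply: Q0; rewrite // inE negb_or xb.
  - by move=> _; rewrite mul_rotationE // eqxx.
apply: (inner (enum (~: (v |: A))%SET)) => //.
- by move=> b; rewrite mem_enum !inE negb_or => /andP[].
- move=> x; rewrite mem_enum !inE negbK => /orP[->//|xA xv].
  by rewrite (fixes_basis_row _ SOQ.1 fA xA) (negbTE xv).
- (* No index besides [v] remains: [Q] is diagonal with determinant [Q v v]. *)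
  move=> l0.
  have xA x : x != v -> x \in A.
    move=> xv; have : x \notin enum (~: (v |: A))%SET by rewrite l0.
    by rewrite mem_enum !inE negbK (negbTE xv).
  suff QE : Q = diag_mx (\row_y if y == v then Q v v else 1).
    have := SOQ.2; rewrite QE det_diag (bigD1 v) //= big1 => [|y yv].
      by rewrite mxE eqxx mulr1 mxE eqxx mxE eqxx => ->.
    by rewrite mxE (negbTE yv).
  apply/matrixP => x y; rewrite !mxE.
  have [->|yv] := eqVneq y v.
    have [->|xv] := eqVneq x v; first by rewrite mulr1n.
    by rewrite (fixes_basis_row _ SOQ.1 fA (xA _ xv)) (negbTE xv).
  by rewrite fA ?xA //; case: (eqVneq x y) => [->|]; rewrite ?(negbTE yv).
Qed.

(** * Reachability of rotations *)

Definition reachable (R : realType) (n m : nat) (A : 'I_m -> 'M[R]_n)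
    (Q : 'M[R]_n) : Prop :=
  exists (T : R) (u : 'I_m -> R -> R) (X : R -> 'M[R]_n),
    [/\ 0 <= T, is_trajectory A T u X & X T = Q].

Lemma is_derive_mxP (R : realType) (m n : nat) (M : R -> 'M[R]_(m, n))
    (t : R) (dM : 'M[R]_(m, n)) :
  is_derive t (1 : R) M dM <->
  forall i j, is_derive t (1 : R) (fun x => M x i j) (dM i j).
Proof.
split=> [[dr dE] i j|dM'].
  apply: DeriveDef; first exact: (derivable_mxP M t 1).1.
  by rewrite -dE derive_mx // mxE.
have dr : derivable M t 1 by apply/derivable_mxP => i j; have [] := dM' i j.
apply: DeriveDef => //; rewrite derive_mx //.
by apply/matrixP => i j; rewrite mxE; have [_ ->] := dM' i j.
Qed.

(** This is the equation of the control system when a single control is switched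
on at time [T], in the state [Q], with the constant value [w]. *)
Lemma is_derive_rotation (R : realType) (n : nat) (a b : 'I_n) (w T t : R)
    (Q : 'M[R]_n) : a != b ->
  is_derive t (1 : R) (fun x => rotation a b (w * (x - T)) *m Q)
    ((w *: Omega R a b) *m (rotation a b (w * (t - T)) *m Q)).
Proof.
move=> ab; apply/is_derive_mxP => x y.
rewrite -scalemxAl mxE mul_OmegaE !mul_rotationE // !eqxx [b == a]eq_sym (negbTE ab).
have -> : (fun s => (rotation a b (w * (s - T)) *m Q) x y) =
    (fun s => if x == a then cos (w * (s - T)) * Q a y + sin (w * (s - T)) * Q b y
    else if x == b then - sin (w * (s - T)) * Q a y + cos (w * (s - T)) * Q b y
    else Q x y).
  by apply/funext => s; rewrite mul_rotationE.
have dl : is_derive t (1 : R) (fun s => w * (s - T)) w.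
  by apply: is_derive_eq; rewrite /GRing.scale /=; ring.
have dc : is_derive t (1 : R) (fun s => cos (w * (s - T))) (- sin (w * (t - T)) * w).
  exact: (is_derive1_comp (is_derive_cos _) dl).
have ds : is_derive t (1 : R) (fun s => sin (w * (s - T))) (cos (w * (t - T)) * w).
  exact: (is_derive1_comp (is_derive_sin _) dl).
case: (eqVneq x a) => [->|xa].
  rewrite (negbTE ab).
  by apply: is_derive_eq; rewrite /GRing.scale /=; ring.
case: (eqVneq x b) => [_|_].
  by apply: is_derive_eq; rewrite /GRing.scale /=; ring.
by apply: is_derive_eq; rewrite /=; ring.
Qed.

Lemma continuous_rotation (R : realType) (n : nat) (a b : 'I_n) (w T : R)
    (Q : 'M[R]_n) : a != b ->
  continuous (fun t : R => rotation a b (w * (t - T)) *m Q).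
Proof.
move=> ab t; apply: (@differentiable_continuous _ R^o).
apply/derivable1_diffP.
by have [] := is_derive_rotation w T t Q ab.
Qed.

Lemma nth_itv_partition_le (R : realType) (T : R) (s : seq R) l :
  itv_partition 0 T s -> (l <= size s)%N -> nth 0 (0 :: s) l <= T.
Proof.
move=> sT ls; rewrite (set_nth_default T) ?ltnS //.
exact: itv_partition_nth_le sT.
Qed.

Lemma reachable1 (R : realType) (n m : nat) (A : 'I_m -> 'M[R]_n) :
  reachable A 1%:M.
Proof.
exists 0, (fun _ _ => 0), (fun=> 1%:M); split=> //; exists [::]; split=> //.
- by apply: continuous_subspaceT => t; exact: cvg_cst.
- by move=> t _; exact: SO1.
- by move=> t /andP[t0 /(lt_trans t0)]; rewrite ltxx.
Qed.

(** A trajectory that reaches [Q] is prolonged by one unit of time, during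
which the control of the edge is the angle [w] and all others vanish. *)
Lemma reachable_rotation (R : realType) (n m : nat) (A : 'I_m -> 'M[R]_n)
    (k : 'I_m) (a b : 'I_n) :
  A k = Omega R a b -> a != b -> rotation_stable (reachable A) a b.
Proof.
move=> Ak ab w Q [T [u [X [T0 [s [[sT su] Xc XSO X0 Xd]] XT]]]].
pose u' k' t := if t < T then u k' t else if k' == k then w else 0.
pose X' t := if t <= T then X t else rotation a b (w * (t - T)) *m Q.
have T1 : T < T + 1 by rewrite ltrDl.
have X'l t : t <= T -> X' t = X t by rewrite /X' => ->.
have X'r t : T <= t -> X' t = rotation a b (w * (t - T)) *m Q.
  rewrite le_eqVlt /X' => /orP[/eqP <-|/lt_geF -> //].
  by rewrite lexx subrr mulr0 rotation0 mul1mx.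
exists (T + 1), u', X'; split; last 1 first.
- by rewrite X'r ?(ltW T1) // addrAC subrr add0r mulr1.
- by rewrite addr_ge0.
exists (rcons s (T + 1)); split.
- split; first by rewrite -cats1; apply: itv_partition_cat sT (itv_partition1 T1).
  move=> l; rewrite size_rcons ltnS leq_eqVlt => /orP[/eqP ->|ls].
    exists (fun k' => if k' == k then w else 0) => t.
    rewrite -rcons_cons !nth_rcons /= ltnS leqnn ltnn eqxx.
    have -> : nth 0 (0 :: s) (size s) = T.
      by case: sT => _ /eqP <-; rewrite -nth_last /=; case: (s).
    by move=> /andP[Tt _] k'; rewrite /u' ltNge (ltW Tt).
  have [c uc] := su l ls; exists c => t.
  rewrite -rcons_cons !nth_rcons /= ltnS (ltnW ls) ltnS ls => tl k'.
  rewrite /u' (lt_le_trans _ (nth_itv_partition_le sT ls)); last by case/andP: tl.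
  exact: uc.
- have -> : [set` `[0, T + 1]] = [set` `[0, T]] `|` [set` `[T, T + 1]] :> set R.
    apply/seteqP; split=> t /=; rewrite !in_itv /=.
      move=> /andP[t0 tT]; case: (leP t T) => tT'; [left|right].
        by rewrite t0.
      by rewrite (ltW tT').
    by case=> /andP[t0 tT]; apply/andP; split => //; lra.
  apply: withinU_continuous; [exact: interval_closed..| |].
    apply: subspace_eq_continuous Xc => t; rewrite inE /= in_itv /= => /andP[_ tT].
    exact/esym/X'l.
  apply: (@subspace_eq_continuous _ _ _
    (fun t : R => rotation a b (w * (t - T)) *m Q)).
    move=> t; rewrite inE /= in_itv /= => /andP[Tt _].
    exact/esym/X'r.
  exact/continuous_subspaceT/continuous_rotation.
- move=> t /andP[t0 tT]; case: (leP t T) => tT'.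
    by rewrite X'l //; apply: XSO; rewrite t0.
  rewrite X'r ?(ltW tT') //; apply: SO_mulmx; first exact: SO_rotation.
  by rewrite -XT; apply: XSO; rewrite T0 lexx.
- by rewrite X'l.
- move=> t /andP[t0 tT]; rewrite mem_rcons inE negb_or => /andP[_ ts].
  case: (ltgtP t T) => tT'.
  + apply: (@near_eq_is_derive _ _ _ X).
      near=> x; rewrite X'l //.
      by near: x; exact: lt_le_nbhsl.
    have -> : (\sum_(k0 < m) u' k0 t *: A k0) *m X' t =
       (\sum_(k0 < m) u k0 t *: A k0) *m X t.
      rewrite X'l ?(ltW tT') //; congr (_ *m _).
      by apply: eq_bigr => k' _; rewrite /u' tT'.
    by apply: Xd => //; rewrite t0.
  + apply: (@near_eq_is_derive _ _ _ (fun t : R => rotation a b (w * (t - T)) *m Q)).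
      near=> x; rewrite X'r //; apply: ltW.
      by near: x; exact: lt_nbhsr.
    rewrite X'r ?(ltW tT') // (bigD1 k) //= big1 ?addr0 => [|k' k'k].
      by rewrite /u' ltNge (ltW tT') /= eqxx Ak; exact: is_derive_rotation.
    by rewrite /u' ltNge (ltW tT') /= (negbTE k'k) scale0r.
  + case/negP: ts; rewrite tT'; have [_ /eqP sl] := sT.
    case: (s) sl => [/= T00|c s' /= <-]; last exact: mem_last.
    by rewrite tT' -T00 ltxx in t0.
Unshelve. all: by end_near. Qed.

(** * Invariant blocks of a disconnected system *)

(** The derivative may fail to exist at the finitely many switching times, so
the mean value theorem is applied between consecutive ones. *)
Lemma itv_partition_constant (R : realType) (f : R -> R) (a b : R) (s : seq R) :
  itv_partition a b s -> {within [set` `[a, b]], continuous f} ->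
  (forall t, a < t < b -> t \notin s -> is_derive t (1 : R) f 0) ->
  f a = f b.
Proof.
elim: s a => [|c s IH] a; first by move=> /itv_partition_nil -> _ _.
move=> sP fc fd; have [/= /andP[ac cs] _] := sP.
have sP' := itv_partition_cons sP; have cb := itv_partition_le sP'.
have sub x y : a <= x -> y <= b -> [set` `[x, y]] `<=` [set` `[a, b]].
  move=> ax yb t /=; rewrite !in_itv /= => /andP[xt ty].
  by rewrite (le_trans ax xt) (le_trans ty yb).
transitivity (f c).
  have fac := continuous_subspaceW (sub a c (lexx _) cb) fc.
  have [t|x _] := MVT (df := fun=> 0) ac _ fac.
    rewrite in_itv /= => /andP[at_ tc]; apply: fd.
      by rewrite at_ (lt_le_trans tc cb).
    have : path <%O t (c :: s) by rewrite /= tc.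
    move=> /(order_path_min lt_trans)/allP h; apply/negP => /h.
    by rewrite ltxx.
  by rewrite mul0r => /eqP; rewrite subr_eq0 => /eqP.
apply: IH => //; first exact: continuous_subspaceW (sub _ _ (ltW ac) (lexx _)) fc.
move=> t /andP[ct tb] ts; apply: fd; first by rewrite (lt_trans ac ct).
by rewrite inE negb_or ts gt_eqF.
Qed.

(** With [W] the diagonal matrix of the weights, [W *m B] is skew-symmetric when
[B] is skew-symmetric and commutes with [W], so its quadratic form vanishes. *)
Lemma skew_quadratic_eq0 (R : realType) (n : nat) (B : 'M[R]_n) (w x : 'I_n -> R) :
  (forall p q, B q p = - B p q) -> (forall p q, w p * B p q = B p q * w q) ->
  \sum_p w p * (2 * (x p * \sum_q B p q * x q)) = 0.
Proof.
move=> skew comm.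
have -> : \sum_p w p * (2 * (x p * \sum_q B p q * x q)) =
    2 * \sum_p \sum_q w p * B p q * x p * x q.
  rewrite mulr_sumr; apply: eq_bigr => p _; rewrite !mulr_sumr.
  by apply: eq_bigr => q _; ring.
set S := \sum_p _; suff : S = - S by lra.
rewrite {1}/S exchange_big /= /S -sumrN; apply: eq_bigr => p _.
rewrite -sumrN; apply: eq_bigr => q _.
by rewrite skew !mulrN comm !mulNr; ring.
Qed.

(** The quantity [E] is the squared length of the part of column [a] outside
[C].  It vanishes at the identity and is a conserved quantity of the system. *)
Lemma reachable_block (R : realType) (n m : nat) (i j : 'I_m -> 'I_n)
    (C : {set 'I_n}) (Q : 'M[R]_n) (a b : 'I_n) :
  (forall k, (i k \in C) = (j k \in C)) ->
  reachable (fun k => Omega R (i k) (j k)) Q ->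
  a \in C -> b \notin C -> Q b a = 0.
Proof.
move=> closedC [T [u [X [T0 [s [[sT su] Xc _ X0 Xd]] <-]]]] aC bC.
pose w x : R := (x \notin C)%:R.
pose E t := \sum_x w x * X t x a ^+ 2.
have E0T : E 0 = E T.
  apply: itv_partition_constant sT _ _.
    pose g (M : 'M[R]_n) := \sum_x w x * M x a ^+ 2.
    have gc : continuous g.
      apply: continuous_big => [|x _]; first exact: add_continuous.
      have cx : continuous (fun M : 'M[R]_n => M x a) by exact: coord_continuous.
      move=> M; apply: (@continuousM R 'M[R]_n (fun=> w x)).
        exact: cst_continuous.
      by apply: (@continuousM R 'M[R]_n _ _ M); exact: cx.
    by apply: (@within_continuous_comp _ _ _ _ X g) Xc => M _; exact: gc.
  (* The derivative of [E] is twice the quadratic form of [W *m B] at [X t]. *)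
  move=> t tT ts; have /is_derive_mxP dX := Xd t tT ts.
  set B := \sum_k _ in dX.
  have -> : E = \sum_(x < n) (fun t => w x * X t x a ^+ 2).
    by apply/funext => r; rewrite fct_sumE.
  have dE (x : 'I_n) : is_derive t (1 : R) (fun r => w x * X r x a ^+ 2)
      (w x * (2 * (X t x a * \sum_q B x q * X t q a))).
    have dx := dX x a; rewrite mxE in dx.
    apply: is_derive_eq; rewrite /GRing.scale /=; ring.
  apply: is_derive_eq.
  have BE p q : B p q = \sum_k u k t * Omega R (i k) (j k) p q.
    by rewrite /B summxE; apply: eq_bigr => k _; rewrite mxE.
  apply: skew_quadratic_eq0 => p q.
    rewrite !BE -sumrN; apply: eq_bigr => k _; rewrite !mxE.
    by rewrite ![(q == _) && _]andbC; ring.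
  have comm c d : (c \in C) = (d \in C) ->
      w p * ((p == c) && (q == d))%:R = ((p == c) && (q == d))%:R * w q.
    by case: (eqVneq p c) => [->|_]; case: (eqVneq q d) => [->|_] /= h;
       rewrite /w ?h ?mulr1 ?mul1r ?mulr0 ?mul0r.
  rewrite !BE mulr_sumr mulr_suml; apply: eq_bigr => k _; rewrite !mxE.
  by rewrite mulrCA -mulrA mulrBr mulrBl !comm.
have ET : E T = 0.
  rewrite -E0T /E X0 big1 // => x _; rewrite mxE /w.
  by case: eqVneq => [->|_]; rewrite ?aC ?mul0r // expr0n mulr0.
have w0 (x : 'I_n) : true -> 0 <= w x * X T x a ^+ 2.
  by move=> _; rewrite mulr_ge0 ?ler0n ?sqr_ge0.
have /eqP := psumr_eq0P w0 ET (i := b) isT.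
by rewrite /w bC mul1r sqrf_eq0 => /eqP.
Qed.

Lemma controllable_iff_spans (R : realType) (n m : nat) (i j : 'I_m -> 'I_n) :
  (forall k, i k != j k) ->
  controllable (fun k => Omega R (i k) (j k)) <-> spans_vertices i j.
Proof.
move=> ij; split=> [ctrl C [a aC] closedC b|conn]; last first.
  apply: rotations_generate_SO; first exact: reachable1.
  apply: (rotation_stable_all conn ij) => k.
  exact: (@reachable_rotation _ _ _ _ k).
apply: contraT => bC; have ab : a != b by apply: contraNneq bC => <-.
have := reachable_block closedC (ctrl _ (SO_rotation (pi / 2) ab)) aC bC.
rewrite -[rotation _ _ _]mulmx1 mul_rotationE // eqxx [b == a]eq_sym (negbTE ab).
rewrite !mxE eqxx [b == a]eq_sym (negbTE ab) sin_pihalf cos_pihalf /= => h.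
by exfalso; lra.
Qed.

(** * Connected graphs and products of transpositions *)

(** The predecessor of [a] is sent to [b] and [b] to [a]: the transposition
inserts [b] just before [a]. *)
Lemma next_cons_tperm (T : finType) (a b : T) (c : seq T) (x : T) :
  uniq [:: b, a & c] ->
  next [:: b, a & c] x = tperm a b (next (a :: c) x).
Proof.
rewrite /= inE negb_or => /and3P[/andP[ba bc] ac _].
(* The condition on [a] excludes that [next_at] falls through and returns [a]
   itself, which the transposition would move. *)
have aux (y : T) p : x != b -> (x = a -> x \in y :: p) -> a \notin p ->
    b \notin p -> next_at x b y p = tperm a b (next_at x a y p).
  move=> xb; elim: p y => [|y' p IH] y xin /=.
    case: (eqVneq x y) => [_ _ _|xy _ _]; first by rewrite tpermL.
    rewrite tpermD // eq_sym //; apply/eqP => /xin.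
    by rewrite inE (negbTE xy).
  rewrite !inE !negb_or => /andP[ay' ap] /andP[by' bp].
  case: (eqVneq x y) xin => [_ _|xy xin]; first by rewrite tpermD.
  by apply: IH => // /xin; rewrite inE (negbTE xy).
case: (eqVneq x b) => [->|xb]; last first.
  by apply: aux => // ->; rewrite inE eqxx.
have next_notin y0 y p : b != y -> b \notin p -> next_at b y0 y p = b.
  elim: p y => [|y' p IH] y by_ /=; first by rewrite (negbTE by_).
  rewrite inE negb_or => /andP[by' bp].
  by rewrite (negbTE by_); apply: IH.
by rewrite /next /= next_notin // tpermR.
Qed.

(** A tree with [k] edges is grown together with the cycle [c] through its
[k.+1] vertices.  Each new edge is listed last, so its transposition is applied
after the others; it is not already listed because one of its ends is new. *)
Lemma exists_cycle_listing (n m : nat) (i j : 'I_m -> 'I_n) (k : nat) :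
  spans_vertices i j -> (k < n)%N ->
  exists (s : seq ('I_n * 'I_n)) (c : seq 'I_n),
    [/\ uniq s, (forall p, p \in s -> exists l, p = (i l, j l)),
        (forall p, p \in s -> (p.1 \in c) && (p.2 \in c)),
        uniq c /\ size c = k.+1
      & forall x, (\prod_(p <- s) tperm p.1 p.2)%g x = next c x].
Proof.
move=> conn; elim: k => [|k IH] kn.
  exists [::], [:: Ordinal kn]; split=> // x; rewrite big_nil perm1 /=.
  by case: eqP.
have [s [c [us sE sc [uc sz] cE]]] := IH (ltnW kn).
have [l [a [b [ac bc ijE]]]] : exists l a b, [/\ a \in c, b \notin c &
    [/\ i l = a & j l = b] \/ [/\ i l = b & j l = a]].
  apply: contrapT => h.
  have : #|[set x in c]%SET| = n.
    rewrite -[RHS]card_ord; apply: eq_card => v; rewrite !inE.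
    suff: v \in [set x in c]%SET by rewrite inE.
    apply: conn => [|l].
      by case: (c) sz => //= y c' _; exists y; rewrite !inE eqxx.
    rewrite !inE; case: (boolP (i l \in c)); case: (boolP (j l \in c)) => //.
      by move=> jl il; case: h; exists l, (i l), (j l); split=> //; left.
    by move=> jl il; case: h; exists l, (j l), (i l); split=> //; right.
  by rewrite cardsE (card_uniqP uc) sz => E; rewrite E ltnn in kn.
(* The insertion lemma needs the cycle to be read from [a]. *)
have [r c' cr] := rot_to ac.
exists (rcons s (i l, j l)), [:: b, a & c'].
have cmem x : (x \in [:: b, a & c']) = (x == b) || (x \in c).
  by rewrite inE -cr mem_rot.
have ubac : uniq [:: b, a & c'] by rewrite cons_uniq -cr mem_rot bc rot_uniq.
have new p : p \in rcons s (i l, j l) -> p = (i l, j l) \/ p \in s.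
  by rewrite mem_rcons inE => /orP[/eqP|]; [left|right].
split=> //.
- rewrite rcons_uniq us andbT; apply/negP => /sc /= /andP[il jl].
  by case: ijE il jl bc => -[-> ->] il jl; rewrite ?il ?jl.
- by move=> p /new[->|/sE//]; exists l.
- move=> p /new[->/=|/sc/andP[p1 p2]]; last by rewrite !cmem p1 p2 !orbT.
  by rewrite !cmem; case: ijE => -[-> ->]; rewrite eqxx ac ?orbT.
- split=> //; rewrite /= -[(size c').+1]/(size (a :: c')) -cr size_rot sz //.
- move=> x; rewrite next_cons_tperm // -cats1 big_cat big_seq1 permM cE.
  have -> : tperm (i l) (j l) = tperm a b.
    by case: ijE => -[-> ->]; rewrite // tpermC.
  by rewrite -cr next_rot.
Qed.

Lemma Omega_inj (R : realType) (n : nat) (p q : 'I_n * 'I_n) :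
  (p.1 < p.2)%N -> Omega R p.1 p.2 = Omega R q.1 q.2 -> p = q.
Proof.
case: p q => [a b] [c d] /= ab /matrixP/(_ a b).
rewrite !mxE !eqxx /=.
have -> : (a == b) = false by apply/negbTE; rewrite neq_ltn ab.
case: (eqVneq a c) => [->|ac] /=.
  case: (eqVneq b d) => [->//|bd].
  by case: (_ && _) => /= h; exfalso; lra.
by case: (_ && _) => /= h; exfalso; lra.
Qed.

(** A set of vertices that no edge leaves is stable under the product of
transpositions, hence under all its powers, and the powers of an n-cycle carry
any vertex to any other. *)
Lemma spans_vertices_of_listing (n m : nat) (i j : 'I_m -> 'I_n)
    (s : seq ('I_n * 'I_n)) :
  (forall p, p \in s -> exists l, p = (i l, j l)) ->
  is_cycle_of_length n (\prod_(p <- s) tperm p.1 p.2)%g ->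
  spans_vertices i j.
Proof.
move=> sE [c [uc cE]] C [v vC] closedC w.
have cT x : x \in c.
  have cn : #|c| = #|'I_n| by rewrite card_ord (card_uniqP uc) size_tuple.
  by have /(subset_cardP cn) -> : c \subset 'I_n by exact/fintype.subsetP.
have stable x : ((\prod_(p <- s) tperm p.1 p.2)%g x \in C) = (x \in C).
  elim: s sE x {cE} => [|p s IH] sE x; first by rewrite big_nil perm1.
  rewrite big_cons permM IH => [|q qs]; last first.
    by apply: sE; rewrite inE qs orbT.
  have [l ->] := sE p (mem_head _ _); rewrite /=.
  by case: tpermP => // ->.
have := fconnect_cycle (cycle_next uc) (cT v) w; rewrite cT.
move=> /iter_findex <-; elim: (findex _ _ _) => //= k IH.
by rewrite -cE stable.
Qed.

Theorem theorem2 (R : realType) (n m : nat) (hn : (3 <= n)%N)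
    (i j : 'I_m -> 'I_n) (hij : forall k : 'I_m, (i k < j k)%N)
    (F : set 'M[R]_n) (hF : F = [set Omega R (i k) (j k) | k in [set: 'I_m]]) :
  controllable (fun k : 'I_m => Omega R (i k) (j k)) <->
  exists S : set 'M[R]_n, S `<=` F /\
    exists sigma : 'S_n, iota_values S sigma /\ is_cycle_of_length n sigma.
Proof.
rewrite controllable_iff_spans; last by move=> k; rewrite neq_ltn hij.
split=> [conn|[S [SF [sigma [[s [us sord SE ->]] cyc]]]]]; last first.
  apply: spans_vertices_of_listing cyc => p ps.
  have : F (Omega R p.1 p.2) by apply: SF; rewrite SE; exists p.
  rewrite hF => -[k _ /esym kE]; exists k.
  exact: (@Omega_inj R n p (i k, j k) (sord p ps) kE).
have [|s [c [us sE _ [uc sc] cE]]] := exists_cycle_listing (k := n.-1) conn.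
  by case: (n) hn.
exists [set Omega R p.1 p.2 | p in [set` s]]; split.
  by move=> _ [p /= /sE[k ->] <-]; rewrite hF; exists k.
exists (\prod_(p <- s) tperm p.1 p.2)%g; split.
  by exists s; split=> // p /sE[k ->] /=; exact: hij.
have cn : size c == n by rewrite sc prednK // (leq_trans _ hn).
by exists (Tuple cn).
Qed.
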